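(* For real $y\ge 0$ let $L(y)=\{x\in[0,1]:T(x)=y\}$ and $L_0(y)=\{x\in[0,\tfrac12]:T(x)=y\}=L(y)\cap[0,\tfrac12]$, where $T$ is the Takagi function. Then: (i) For all $y$, $$L(y)=L_0(y)\cup[1-L_0(y)],$$ where the union is disjoint except when $y=\frac12$. (ii) For $y\in I_k$ ($k\ge 3$), we have $$L_0(y)=f_k\left[L_0(\Psi(y))\right]\cup\bigcup_{j=0}^\infty g_{k,j}\left[L(4^j\Phi(y))\right],$$ where the union is completely disjoint (all the sets in it are pairwise disjoint) except when $y=t_k$. (iii) For $y\in I_2$, $$L_0(y)=\bigcup_{j=0}^\infty g_{1,j}\left[L(4^j\Phi(y))\right],$$ with the union disjoint except when $y=\frac12$.
   Context: Let $\phi(x)=\operatorname{dist}(x,\mathbb{Z})$; the Takagi function is $T(x)=\sum_{n=0}^\infty 2^{-n}\phi(2^nx)$. Its range on $[0,1]$ is $[0,\frac23]$, so $L(y)=\emptyset$ for $y>\frac23$. For a set $A$ and a map $f$, $f[A]$ is the image of $A$ under $f$, and $1-A=\{1-a:a\in A\}$. For $k\in\mathbb{N}$ define affine maps $$f_k(x)=\frac{x}{4}+\frac1{2^k},\qquad g_{k,j}(x)=\frac{x}{4^{k+j}}+\frac{1}{2^k}-\sum_{r=0}^j\frac{1}{4^{k+r}},\quad j=0,1,2,\dots$$ Let $t_k=k/2^k$ for $k\in\mathbb{N}$ (so $t_1=t_2=\frac12$, and $t_k$ is strictly decreasing thereafter), $I_2=[\frac12,\frac23]$, and $I_k=[t_k,t_{k-1})$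 for $k\ge3$. Thus $[0,\frac23]$ is the disjoint union of $\{0\}$ and the intervals $I_k$, $k\ge 2$. Define $\Psi:[0,\frac23]\to[0,\frac23]$ by $\Psi(0)=0$ and $\Psi(y)=4(y-t_k)$ if $y\in I_k$ ($k\ge 2$). Define $\Phi:[0,\infty)\to[0,\infty)$ by $\Phi(0)=0$; $\Phi(y)=4^k(y-t_k)$ if $y\in I_k$ with $k\ge3$; $\Phi(y)=4(y-\frac12)$ if $y\ge\frac12$.
   Formalization: The equality in (ii) at y=t_k and in (iii) at y=1/2 is false as printed (T(1/6)=1/2, but 1/6 is in no g_{1,j}-image); there the single limit point 2^{-k}-(4/3)4^{-k} (k=1 in (iii), giving 1/6) is added to the union. *)

(* Defs.v *)
From HB Require Import structures.
From mathcomp Require Import all_boot all_order all_algebra.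
From mathcomp Require Import all_classical all_reals all_analysis.

Set Implicit Arguments.
Unset Strict Implicit.
Unset Printing Implicit Defensive.

Import Order.TTheory GRing.Theory Num.Theory.
Import numFieldNormedType.Exports.

Local Open Scope classical_set_scope.
Local Open Scope ring_scope.

Section Takagi.
Context {R : realType}.
Implicit Types (x y : R) (j k : nat).

Definition distZ x : R := inf [set `|x - m%:~R| | m in [set: int]].

Definition takagi x : R :=
  limn (series (fun n => 2 ^- n * distZ (2 ^+ n * x))).

Definition L y : set R := [set x | x \in `[0, 1] /\ takagi x = y].

Definition L0 y : set R := [set x | x \in `[0, 2^-1] /\ takagi x = y].

Definition f k x : R := x / 4 + 2 ^- k.

Definition g k j x : R :=
  x / 4 ^+ (k + j) + 2 ^- k - \sum_(0 <= r < j.+1) 4 ^- (k + r).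

(* Limit of [g k j x] as [j] tends to infinity, for every [x]:
   2^-k - \sum_(r >= 0) 4^-(k + r) = 2^-k - (4 / 3) 4^-k.
   It lies strictly below every point [g k j x] with 0 <= x, and, by continuity
   of [takagi], at height [t k]: e.g. takagi (1 / 6) = 1 / 2 for [k = 1]. *)
Definition g_lim k : R := 2 ^- k - 4 / 3 * 4 ^- k.

Definition t k : R := k%:R / 2 ^+ k.

(* Only meaningful for [2 <= k]. *)
Definition Ik k : set R :=
  if k == 2%N then [set` `[2^-1, 2 / 3]] else [set` `[t k, t k.-1[].

(* The unique [k >= 2] with [y] in [Ik k] when 0 < y <= 2/3;
   the default value 0 is only returned for other [y]. *)
Definition index y : nat := xget 0%N [set k | (2 <= k)%N /\ Ik k y].

(* Only meaningful on [0, 2/3]. *)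
Definition Psi y : R := if y == 0 then 0 else 4 * (y - t (index y)).

(* Only meaningful on [0, +oo[. *)
Definition Phi y : R :=
  if y == 0 then 0
  else if 2^-1 <= y then 4 * (y - 2^-1)
  else 4 ^+ index y * (y - t (index y)).

End Takagi.

(* Main.v *)
(* Idea. Everything follows from T(x) = x + T(2x)/2 on [0, 1/2] and
   T(1 - x) = T(x). To the right of 2^-k, T(2^-k + x/4) = t_k + T(x)/4, which
   yields the piece f_k; further right T >= t_(k-1). To the left,
   T(2^-k - (1 + z)/4^k) = t_k + (T(z) - 2z)/4^k for 0 <= z <= 1, and the defect
   T(z) - 2z is divided by 4 under z |-> (1 + z)/4, whose fixed point is 1/3.
   Hence the defect is negative for z > 1/3 and vanishes at 1/3 (the point
   g_lim k), while the part z < 1/3 is tiled by copies of [0, 1], each a quarter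
   the size of the previous one, which are the pieces g_{k,j}. In the closed form
   g k j x = g_lim k + (x + 1/3)/4^(k+j), consecutive pieces meet only at
   endpoints, where T = t_k. *)
Require Import Defs.
From HB Require Import structures.
From mathcomp Require Import all_boot all_order all_algebra.
From mathcomp Require Import all_classical all_reals all_analysis.
From mathcomp Require Import ring lra.

Set Implicit Arguments.
Unset Strict Implicit.
Unset Printing Implicit Defensive.

Import Order.TTheory GRing.Theory Num.Theory.
Import numFieldNormedType.Exports.

Local Open Scope classical_set_scope.
Local Open Scope ring_scope.

(** * The functional equation of the Takagi function and its bound 2/3 *)

Section FunctionalEquation.
Context {R : realType}.
Implicit Types (x y : R) (n : nat).

Lemma distZ_set_lb x :
  has_lbound [set `|x - m%:~R| | m in [set: int]].
Proof. by exists 0 => _ [m _ <-]. Qed.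

Lemma distZ_set_nonempty x :
  [set `|x - m%:~R| | m in [set: int]] !=set0.
Proof. by exists `|x - 0%:~R|; exists 0. Qed.

Lemma distZ_le x (m : int) : distZ x <= `|x - m%:~R|.
Proof. by apply: ge_inf; [exact: distZ_set_lb|exists m]. Qed.

Lemma distZ_ge0 x : 0 <= distZ x.
Proof.
by apply: lb_le_inf; [exact: distZ_set_nonempty|move=> _ [m _ <-]].
Qed.

Lemma distZ_small x : 0 <= x <= 2^-1 -> distZ x = x.
Proof.
move=> /andP[x0 x1]; apply/le_anti/andP; split.
  by have := distZ_le x 0; rewrite subr0 ger0_norm.
apply: lb_le_inf; first exact: distZ_set_nonempty.
move=> _ [m _ <-]; have [m0|m1] := leP m 0.
  have : m%:~R <= 0 :> R by rewrite lerz0.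
  by move=> ?; rewrite ger0_norm; lra.
have : 1 <= m%:~R :> R by rewrite ler1z.
by move=> ?; rewrite ler0_norm; lra.
Qed.

Lemma distZ_subl (m : int) x : distZ (m%:~R - x) = distZ x.
Proof.
rewrite /distZ; congr inf; apply/seteqP; split=> _ [n _ <-];
  exists (m - n) => //; rewrite rmorphB /=.
- by rewrite -normrN; congr (`|_|); ring.
- by rewrite -normrN; congr (`|_|); ring.
Qed.

(** Let m be the floor of [x] and u = x - m. If u <= 1/2, comparing with the integers m and 2m + 1
    gives u + (1 - 2u)/2 = 1/2; for u > 1/2, m + 1 and 2m + 1 give the same total. *)
Lemma distZ_two_terms x :
  distZ x <= 2^-1 /\ distZ x + distZ (2 * x) / 2 <= 2^-1.
Proof.
have /andP[z0 z1] := floor_itv x.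
set m := Num.floor x in z0 z1; rewrite rmorphD /= in z1.
have h0 := distZ_le x m.
have h1 := distZ_le x (m + 1).
have h2 := distZ_le (2 * x) (2 * m + 1).
rewrite !(rmorphD, rmorphM) /= in h1 h2.
rewrite ger0_norm in h0; last by lra.
rewrite ler0_norm in h1; last by lra.
have [z2|z2] := leP (x - m%:~R) 2^-1.
- rewrite ler0_norm in h2; last by lra.
  by split; lra.
- rewrite ger0_norm in h2; last by lra.
  by split; lra.
Qed.

Let S x : R ^nat := series (fun n => 2 ^- n * distZ (2 ^+ n * x)).

Lemma takagi_seriesS x n : S x n.+1 = distZ x + S (2 * x) n / 2.
Proof.
rewrite /S /series /= big_nat_recl //= expr0 invr1 !mul1r; congr (_ + _).
rewrite mulr_suml; apply: eq_bigr => i _.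
by rewrite !exprSr !mulrA invfM; ring.
Qed.

(** Terms are taken in pairs: a pair contributes at most 1/2 and leaves a tail weighted by 1/4, and
    1/2 + (2/3)/4 = 2/3. *)
Lemma takagi_series_le x n : S x n <= 2 / 3.
Proof.
elim/ltn_ind: n x => -[|[|n]] IH x.
- by rewrite /S /series /= big_geq.
- rewrite takagi_seriesS /S /series /= big_geq //.
  by have [] := distZ_two_terms x; lra.
- rewrite !takagi_seriesS.
  have [_] := distZ_two_terms x.
  by have := IH n (ltnW (ltnSn _)) (2 * (2 * x)); lra.
Qed.

Lemma takagi_series_nondecreasing x : nondecreasing_seq (S x).
Proof.
apply/nondecreasing_seqP => n.
by rewrite /S /series /= big_nat_recr //= lerDl mulr_ge0 ?distZ_ge0.
Qed.

Lemma takagi_cvg x : S x @ \oo --> takagi x.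
Proof.
apply: nondecreasing_is_cvgn; first exact: takagi_series_nondecreasing.
by exists (2 / 3) => _ [n _ <-]; exact: takagi_series_le.
Qed.

Lemma takagi_ge0 x : 0 <= takagi x.
Proof.
have := nondecreasing_cvgn_le (@takagi_series_nondecreasing x)
  (cvgP _ (@takagi_cvg x)) 0%N.
by rewrite /S {1}/series /= big_geq.
Qed.

Lemma takagi_le x : takagi x <= 2 / 3.
Proof.
by apply: limr_le; [exact: cvgP (@takagi_cvg x)|
  apply: nearW => n; exact: takagi_series_le].
Qed.

Lemma takagi_distZ x : takagi x = distZ x + takagi (2 * x) / 2.
Proof.
have cvgS : S x @ \oo --> distZ x + takagi (2 * x) / 2.
  rewrite -cvg_shiftS.
  rewrite (_ : (fun n => S x n.+1) = (fun n => distZ x + S (2 * x) n / 2)).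
    by apply: cvgD; [exact: cvg_cst|apply: cvgMl; exact: takagi_cvg].
  by apply/funext => n; rewrite takagi_seriesS.
by rewrite /takagi; exact: (cvg_lim _ cvgS).
Qed.

Lemma takagi_half x : 0 <= x <= 2^-1 -> takagi x = x + takagi (2 * x) / 2.
Proof. by move=> hx; rewrite takagi_distZ distZ_small. Qed.

Lemma takagi_sym x : takagi (1 - x) = takagi x.
Proof.
rewrite /takagi; congr (limn (series _)); apply/funext => n; congr (_ * _).
rewrite mulrBr mulr1 -(distZ_subl (2 ^+ n) (2 ^+ n * x)).
by rewrite rmorphXn.
Qed.

Lemma takagi0 : takagi 0 = 0 :> R.
Proof. by have := @takagi_half 0; rewrite mulr0; lra. Qed.

Lemma takagi1 : takagi 1 = 0 :> R.
Proof. by rewrite -takagi_sym subrr takagi0. Qed.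

Lemma takagi_1half : takagi (2^-1) = 2^-1 :> R.
Proof. by rewrite takagi_half ?mulfV ?takagi1 //; lra. Qed.

End FunctionalEquation.

(** * Values of the Takagi function around 2^-k *)

Section DyadicNeighbourhoods.
Context {R : realType}.
Implicit Types (v w x y z : R) (j k n : nat).

Lemma pow2_ge1 k : 1 <= 2 ^+ k :> R.
Proof. by rewrite exprn_ege1 // ler1n. Qed.

Lemma pow4_ge1 k : 1 <= 4 ^+ k :> R.
Proof. by rewrite exprn_ege1 // ler1n. Qed.

Lemma pow4E k : 4 ^+ k = 2 ^+ k * 2 ^+ k :> R.
Proof. by rewrite -exprMn; congr (_ ^+ k); ring. Qed.

(** Each of the [k] doublings starts from a point of [0, 1/2], so [takagi_half] applies every time
    and contributes one [x]. *)
Lemma takagi_scale k x : 0 <= x -> 2 ^+ k * x <= 1 ->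
  takagi x = k%:R * x + takagi (2 ^+ k * x) / 2 ^+ k.
Proof.
elim: k x => [|k IH] x x0 hx; first by rewrite expr0 mul1r divr1; ring.
have p1 := pow2_ge1 k; rewrite exprSr -mulrA in hx *.
rewrite (@takagi_half _ x); last by apply/andP; split; nra.
rewrite IH //; last by lra.
rewrite -natr1; field; lra.
Qed.

Lemma takagi_half_shift z : 0 <= z <= 1 ->
  takagi ((1 + z) / 2) = (1 - z) / 2 + takagi z / 2.
Proof.
move=> hz; rewrite -takagi_sym takagi_half; last by lra.
congr (_ + _ / 2); first by field.
by rewrite -takagi_sym; congr takagi; field.
Qed.

Lemma takagi_quarter_shift z : 0 <= z <= 1 ->
  takagi ((1 + z) / 4) = 2^-1 + takagi z / 4.
Proof.
move=> hz; rewrite takagi_half; last by lra.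
rewrite (_ : 2 * _ = (1 + z) / 2); last by field.
by rewrite takagi_half_shift //; field.
Qed.

Lemma takagi_quarter z : 0 <= z <= 1 -> takagi (z / 4) = z / 2 + takagi z / 4.
Proof.
move=> hz; rewrite takagi_half; last by lra.
rewrite (takagi_half (x := 2 * (z / 4))); last by lra.
by rewrite (_ : 2 * (2 * (z / 4)) = z); [|]; field.
Qed.

(** Doubling lowers the slope by one. Once v > 1/2 the bound 2/3 suffices, since the slope is then
    at least 2. *)
Lemma takagi_lt_linear k v : 1 < 2 ^+ k * v -> v <= 1 ->
  takagi v < k.+1%:R * v.
Proof.
elim: k v => [|k IH] v; first by rewrite expr0 mul1r; lra.
move=> hv v1; have p1 := pow2_ge1 k.
have v0 : 0 < v.
  by rewrite -(@pmulr_rgt0 _ (2 ^+ k.+1)) ?exprn_gt0 //; lra.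
rewrite exprSr -mulrA in hv.
have [v2|v2] := leP v 2^-1.
  rewrite takagi_half; last by lra.
  by have := IH _ hv; rewrite -(@natr1 _ k.+1); lra.
have := takagi_le v; have : 0 <= k%:R * v by rewrite mulr_ge0 // ltW.
by rewrite -(@natr1 _ k.+1) -(@natr1 _ k); lra.
Qed.

(** Up to 1/4, doubling reduces to the previous index; on [1/4, 1/2] the quarter shift already gives
    height at least 1/2. Contraposed, a low value confines the point to the left of 2^-k. *)
Lemma takagi_ge_t k x : (0 < k)%N -> 1 <= 2 ^+ k * x -> x <= 2^-1 ->
  t k <= takagi x.
Proof.
case: k => // k _; elim: k x => [|k IH] x.
  rewrite /t !expr1 => h1 h2; have -> : x = 2^-1 by lra.
  by rewrite takagi_1half; lra.
move=> hx x2; have p1 := pow2_ge1 k.+1.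
rewrite exprSr -mulrA in hx.
have x0 : 0 < x by rewrite -(@pmulr_rgt0 _ (2 ^+ k.+1 * 2)); lra.
have [x4|x4] := leP x 4^-1.
  rewrite takagi_half; last by lra.
  have h : t k.+1 <= takagi (2 * x) by apply: (IH _ hx); lra.
  have hp : (2 ^+ k.+2)^-1 <= x :> R.
    by rewrite -div1r ler_pdivrMr ?exprn_gt0 // (exprSr _ k.+1); lra.
  have -> : t k.+2 = (2 ^+ k.+2)^-1 + t k.+1 / 2 :> R.
    by rewrite /t -natr1 (exprSr _ k.+1); field; lra.
  by lra.
have -> : x = (1 + (4 * x - 1)) / 4 by field.
rewrite takagi_quarter_shift; last by lra.
have := takagi_ge0 (4 * x - 1).
suff : t k.+2 <= 2^-1 :> R by lra.
rewrite /t ler_pdivrMr ?exprn_gt0 // exprSr mulrC mulfK // -natrX ler_nat.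
exact: ltn_expl.
Qed.

Lemma t_gt0 k : (0 < k)%N -> 0 < t k :> R.
Proof. by move=> k0; rewrite /t divr_gt0 ?ltr0n // exprn_gt0. Qed.

Lemma t_nonincreasing k n : (0 < k)%N -> (k <= n)%N -> t n <= t k :> R.
Proof.
move=> k0 /subnKC <-; elim: (n - k)%N => [|m]; first by rewrite addn0.
apply: le_trans; rewrite addnS /t exprSr -natr1.
have km : 1 <= (k + m)%:R :> R by rewrite ler1n addn_gt0 k0.
have p1 := pow2_ge1 (k + m).
rewrite ler_pdivrMr; last by lra.
by rewrite mulrA divfK; [lra|lra].
Qed.

(** After [k] doublings the point sits just left of 1, where the symmetry of T applies. *)
Lemma takagi_far_dyadic k w : 0 <= w <= 2 ^+ k ->
  takagi (2 ^- k - w / 4 ^+ k) =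
  t k + (takagi (w / 2 ^+ k) - k%:R * (w / 2 ^+ k)) / 2 ^+ k.
Proof.
move=> /andP[w0 w1]; have p1 := pow2_ge1 k.
have pw : w / 2 ^+ k <= 1 by rewrite ler_pdivrMr; lra.
have pw0 : 0 <= w / 2 ^+ k by rewrite divr_ge0 //; lra.
have e : 2 ^+ k * (2 ^- k - w / 4 ^+ k) = 1 - w / 2 ^+ k.
  by rewrite pow4E; field; lra.
rewrite (@takagi_scale k) ?e.
- by rewrite takagi_sym /t pow4E; field; lra.
- by rewrite -(@pmulr_rge0 _ (2 ^+ k)) ?e; lra.
- lra.
Qed.

(** Here [k] further doublings of w / 2^k stay in range, and their linear part cancels the term -k w
    / 2^k. *)
Lemma takagi_near_dyadic k w : 0 <= w <= 1 ->
  takagi (2 ^- k - w / 4 ^+ k) = t k + takagi w / 4 ^+ k.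
Proof.
move=> /andP[w0 w1]; have p1 := pow2_ge1 k.
rewrite takagi_far_dyadic; last by lra.
have e : 2 ^+ k * (w / 2 ^+ k) = w by field; lra.
rewrite (@takagi_scale k (w / 2 ^+ k)) ?e //; last by rewrite divr_ge0 //; lra.
by rewrite pow4E; field; lra.
Qed.

(** Only k - 1 doublings are available before the point passes 1/2; the half shift used for the last
    one produces the defect T(z) - 2z. *)
Lemma takagi_mid_dyadic k z : (0 < k)%N -> 0 <= z <= 1 ->
  takagi (2 ^- k - (1 + z) / 4 ^+ k) = t k + (takagi z - 2 * z) / 4 ^+ k.
Proof.
case: k => // k _ hz; have p1 := pow2_ge1 k.
rewrite takagi_far_dyadic; last by rewrite exprSr; lra.
have e : 2 ^+ k * ((1 + z) / 2 ^+ k.+1) = (1 + z) / 2.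
  by rewrite exprSr; field; lra.
rewrite (@takagi_scale k) ?e; last by lra.
- rewrite takagi_half_shift // -natr1 pow4E exprSr; field; lra.
- by rewrite divr_ge0 ?exprn_ge0 //; lra.
Qed.

Lemma takagi_low k w : (0 < k)%N -> 2 < w -> w <= 2 ^+ k ->
  takagi (2 ^- k - w / 4 ^+ k) < t k.
Proof.
case: k => // k _ w2 wk; have p1 := pow2_ge1 k.
rewrite takagi_far_dyadic; last by lra.
rewrite gtrDl pmulr_llt0 ?invr_gt0 ?exprn_gt0 // subr_lt0.
apply: takagi_lt_linear; last first.
  by rewrite ler_pdivrMr; rewrite exprSr in wk *; lra.
rewrite exprSr (_ : _ * _ = w / 2); first by lra.
by field; lra.
Qed.

Lemma takagi_lt_double z : 3^-1 < z -> z <= 1 -> takagi z < 2 * z.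
Proof.
move=> z3 z1.
(* The map z |-> 4z - 1 quadruples the distance to 1/3. As 1/6 = 1/2 - 1/3, the condition says that
   [n] iterations suffice to reach 1/2, where 2z >= 1 > 2/3. *)
have [n hn] : exists n, 1 <= 4 ^+ n * (6 * (z - 3^-1)).
  have e0 : 0 < (6 * (z - 3^-1))^-1 by rewrite invr_gt0; lra.
  exists (Num.bound (6 * (z - 3^-1))^-1).
  rewrite -ler_pdivrMr; last by lra.
  rewrite div1r; apply: ltW; apply: lt_le_trans (archi_boundP (ltW e0)) _.
  by rewrite -natrX ler_nat ltnW // ltn_expl.
elim: n z z3 z1 hn => [|n IH] z z3 z1.
  by rewrite expr0 => hn; have := takagi_le z; lra.
rewrite exprSr -mulrA => hn.
have [z2|z2] := leP 2^-1 z; first by have := takagi_le z; lra.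
have IHz : takagi (4 * z - 1) < 2 * (4 * z - 1).
  apply: IH; [lra|lra|].
  by rewrite (_ : 6 * _ = 4 * (6 * (z - 3^-1))) //; field.
have -> : takagi z = 2^-1 + takagi (4 * z - 1) / 4; last by lra.
by rewrite -takagi_quarter_shift; [congr takagi; field|lra].
Qed.

Lemma takagi_third : takagi 3^-1 = 2 / 3 :> R.
Proof.
have := @takagi_quarter_shift 3^-1.
rewrite (_ : (1 + 3^-1) / 4 = 3^-1); last by field.
lra.
Qed.

(** The first point is (1 - x)/4, and z |-> (1 + z)/4 carries each point to the next while dividing
    its defect by 4. *)
Lemma takagi_below_third j x : 0 <= x <= 1 ->
  takagi (3^-1 - (x + 3^-1) / 4 ^+ j.+1) -
    2 * (3^-1 - (x + 3^-1) / 4 ^+ j.+1) = takagi x / 4 ^+ j.+1.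
Proof.
move=> hx; elim: j => [|j IH].
  rewrite expr1 (_ : 3^-1 - _ = (1 - x) / 4); last by field.
  by rewrite takagi_quarter ?takagi_sym; lra.
have q1 := pow4_ge1 j.+1.
set z := 3^-1 - (x + 3^-1) / 4 ^+ j.+1 in IH.
have hz : 0 <= z <= 1.
  have h : 0 <= (x + 3^-1) / 4 ^+ j.+1 <= 3^-1.
    rewrite divr_ge0 ?exprn_ge0 //=; last by lra.
    by rewrite ler_pdivrMr ?exprn_gt0 // exprS; have := pow4_ge1 j; lra.
  by rewrite /z; lra.
rewrite (_ : 3^-1 - _ / 4 ^+ j.+2 = (1 + z) / 4); last first.
  by rewrite /z (exprSr _ j.+1); field; lra.
rewrite takagi_quarter_shift // (exprSr _ j.+1) invfM [RHS]mulrA -IH; lra.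
Qed.

(** * The affine maps [g k j] and [f k]: heights, covering and overlaps *)

Lemma gE k j x : g k j x = g_lim k + (x + 3^-1) / 4 ^+ (k + j).
Proof.
rewrite /g /g_lim.
suff -> : \sum_(0 <= r < j.+1) 4 ^- (k + r) =
    4 / 3 * 4 ^- k - 3^-1 / 4 ^+ (k + j) :> R by ring.
have q1 := pow4_ge1 k.
elim: j => [|j IH]; first by rewrite big_nat1 addn0; field; lra.
have q2 := pow4_ge1 (k + j).
by rewrite big_nat_recr //= IH addnS exprSr; field; lra.
Qed.

(** The piece j = 0 lies within 4^-k of 2^-k, where [takagi_near_dyadic] applies; all later pieces
    fall under [takagi_mid_dyadic], with z below 1/3. *)
Lemma takagi_g k j x : (0 < k)%N -> 0 <= x <= 1 ->
  takagi (g k j x) = t k + takagi x / 4 ^+ (k + j).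
Proof.
move=> k0 hx; have q1 := pow4_ge1 k; case: j => [|j].
  rewrite gE addn0 (_ : _ + _ = 2 ^- k - (1 - x) / 4 ^+ k).
    by rewrite takagi_near_dyadic ?takagi_sym //; lra.
  by rewrite /g_lim; lra.
have q2 := pow4_ge1 j.+1.
rewrite gE exprD.
rewrite (_ : _ + _ = 2 ^- k - (1 + (3^-1 - (x + 3^-1) / 4 ^+ j.+1)) / 4 ^+ k).
  rewrite takagi_mid_dyadic // ?takagi_below_third //; first by field; lra.
  have h : 0 <= (x + 3^-1) / 4 ^+ j.+1 <= 3^-1.
    rewrite divr_ge0 ?exprn_ge0 //=; last by lra.
    by rewrite ler_pdivrMr ?exprn_gt0 // exprS; have := pow4_ge1 j; lra.
  lra.
by rewrite /g_lim; field; rewrite !expf_neq0.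
Qed.

Lemma takagi_g_lim k : (0 < k)%N -> takagi (g_lim k) = t k :> R.
Proof.
move=> k0; rewrite /g_lim (_ : 4 / 3 * _ = (1 + 3^-1) / 4 ^+ k);
  last by field; rewrite expf_neq0.
by rewrite takagi_mid_dyadic ?takagi_third //; lra.
Qed.

Lemma takagi_below_g_lim k x : (0 < k)%N -> 0 <= x -> x < g_lim k ->
  takagi x < t k.
Proof.
move=> k0 x0 xg; have q1 := pow4_ge1 k; have p1 := pow2_ge1 k.
(* In this coordinate [g_lim k] sits at 4/3. Beyond 2 [takagi_low] applies; between 4/3 and 2 the
   defect at z = w - 1 > 1/3 is negative. *)
pose w := 4 ^+ k * (2 ^- k - x).
have xE : x = 2 ^- k - w / 4 ^+ k by rewrite /w; field; lra.
have wk : w <= 2 ^+ k.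
  rewrite (_ : 2 ^+ k = 4 ^+ k * 2 ^- k); last by rewrite pow4E; field; lra.
  by rewrite ler_pM2l; lra.
have w3 : 4 / 3 < w.
  rewrite -[_ / 3](mulfVK (x := 4 ^+ k)); last by lra.
  by rewrite mulrC ltr_pM2l; [move: xg; rewrite /g_lim; lra|lra].
have [w2|w2] := ltP 2 w; first by rewrite xE; exact: takagi_low.
rewrite xE (_ : w = 1 + (w - 1)); last by ring.
rewrite takagi_mid_dyadic //; last by lra.
rewrite gtrDl pmulr_llt0 ?invr_gt0 ?exprn_gt0 // subr_lt0.
by apply: takagi_lt_double; lra.
Qed.

Lemma g_surj k x : g_lim k < x -> x <= 2 ^- k ->
  exists j x', 0 <= x' <= 1 /\ x = g k j x'.
Proof.
move=> xg xk; have q1 := pow4_ge1 k.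
pose e := 4 ^+ k * (x - g_lim k).
have e0 : 0 < e by rewrite /e pmulr_rgt0; lra.
have e1 : e <= 4 / 3.
  rewrite -[_ / 3](mulfVK (x := 4 ^+ k)); last by lra.
  by rewrite mulrC ler_pM2l; [move: xk; rewrite /g_lim; lra|lra].
have ex : exists n, 3^-1 <= 4 ^+ n * e.
  have e2 : 0 <= e^-1 by rewrite invr_ge0 ltW.
  exists (Num.bound e^-1); rewrite -ler_pdivrMr //.
  apply: (@le_trans _ _ e^-1); first by rewrite ler_piMl //; lra.
  apply/ltW/(lt_le_trans (archi_boundP e2)).
  by rewrite -natrX ler_nat ltnW // ltn_expl.
(* The preimage is 4^j e - 1/3. The choice of [j] makes it nonnegative, and minimality gives 4^j e <
   4/3, hence at most 1; for j = 0 this is [e1]. *)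
case: (ex_minnP ex) => j hj jmin.
have q2 := pow4_ge1 j.
exists j, (4 ^+ j * e - 3^-1); split; last by rewrite gE exprD /e; field; lra.
rewrite subr_ge0 hj /=.
case: j hj jmin q2 => [|j] hj jmin q2; first by rewrite expr0; lra.
have : 4 ^+ j * e < 3^-1 by rewrite ltNge; apply/negP => /jmin; rewrite ltnn.
by rewrite exprS; lra.
Qed.

Lemma g_lim_ge0 k : (0 < k)%N -> 0 <= g_lim k :> R.
Proof.
case: k => // k _; rewrite /g_lim pow4E invfM exprS; have p1 := pow2_ge1 k.
have h : (2 ^+ k)^-1 <= 1 :> R by rewrite invf_le1 //; lra.
have h0 : 0 < (2 ^+ k)^-1 :> R by rewrite invr_gt0; lra.
rewrite invfM; nra.
Qed.

Lemma g_bounds k j x : 0 <= x <= 1 -> g_lim k < g k j x <= 2 ^- k.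
Proof.
move=> hx; rewrite gE ltrDl divr_gt0 ?exprn_gt0 //=; last by lra.
have q1 := pow4_ge1 k; have q2 := pow4_ge1 j.
rewrite /g_lim -[leRHS](subrK (4 / 3 * 4 ^- k)) lerD2l exprD invfM mulrA.
rewrite mulrAC ler_pM2r ?invr_gt0 ?exprn_gt0 // ler_pdivrMr; nra.
Qed.

(** By the closed form, x + 1/3 = (y + 1/3)/4^(j-i) <= (4/3)/4 = 1/3. *)
Lemma g_overlap k i j x y : (i < j)%N -> 0 <= x <= 1 -> 0 <= y <= 1 ->
  g k i x = g k j y -> x = 0.
Proof.
move=> ij hx hy; rewrite !gE => /addrI; rewrite !exprD !invfM !mulrA.
have q1 := pow4_ge1 k; have q2 := pow4_ge1 i; have q3 := pow4_ge1 (j - i.+1)%N.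
rewrite -!mulrA ![4 ^- k * _]mulrC !mulrA => /mulIf => /(_ _)h.
have {h} : (x + 3^-1) / 4 ^+ i = (y + 3^-1) / 4 ^+ j.
  by apply: h; rewrite invr_eq0; lra.
rewrite -(subnKC ij) exprD exprS.
have {}q3 : (4 ^+ (j - i.+1))^-1 <= 1 :> R by rewrite invf_le1; lra.
have q4 : 0 < (4 ^+ (j - i.+1))^-1 :> R by rewrite invr_gt0 exprn_gt0.
rewrite !invfM => e.
have : (x + 3^-1) = (y + 3^-1) * (4^-1 * (4 ^+ (j - i.+1))^-1).
  apply: (@mulIf _ (4 ^+ i)^-1); first by rewrite invr_eq0; lra.
  by rewrite e; ring.
nra.
Qed.

(** Put u = 2^(k-2) x, so that u <= 1. Then k - 1 doublings bring [f k x] to (1 + u)/2, while k - 2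
    doublings bring [x] to u. *)
Lemma takagi_f k x : (1 < k)%N -> 0 <= x -> 2 ^+ k * x <= 4 ->
  takagi (f k x) = t k + takagi x / 4.
Proof.
case: k => [|[|k]] // _ x0; rewrite 2!exprSr -2!mulrA => hx.
have p1 := pow2_ge1 k.
have hx1 : 2 ^+ k * x <= 1 by lra.
have hx0 : 0 <= 2 ^+ k * x by rewrite mulr_ge0 //; lra.
have e : 2 ^+ k.+1 * f k.+2 x = (1 + 2 ^+ k * x) / 2.
  by rewrite /f !exprSr; field; lra.
rewrite (@takagi_scale k.+1) ?e; last by lra.
  2: by rewrite /f addr_ge0 ?invr_ge0 ?exprn_ge0 //; lra.
rewrite takagi_half_shift; last by lra.
rewrite (@takagi_scale k x) // /t /f !exprSr -(@natr1 _ k.+1) -(@natr1 _ k).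
field; lra.
Qed.

End DyadicNeighbourhoods.

(** * Decomposition of the level sets *)

Section LevelSets.
Context {R : realType}.
Implicit Types (x y : R) (j k : nat).

Lemma g_image_L k j y x : (0 < k)%N ->
  (g k j @` L (4 ^+ j * (4 ^+ k * (y - t k)))) x ->
  g_lim k < x <= 2 ^- k /\ takagi x = y.
Proof.
move=> k0 [z [hz Tz] <-]; rewrite /= in_itv /= in hz.
split; first exact: g_bounds.
have q1 := pow4_ge1 (R := R) k; have q2 := pow4_ge1 (R := R) j.
by rewrite takagi_g // Tz exprD; field; lra.
Qed.

Lemma dyadic_level k x : (0 < k)%N -> 0 <= x <= 2 ^- k -> t k <= takagi x ->
  x = g_lim k \/
  exists j, (g k j @` L (4 ^+ j * (4 ^+ k * (takagi x - t k)))) x.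
Proof.
move=> k0 /andP[x0 xk] tx.
have [xg|gx|->] := ltgtP x (g_lim k); last by left.
- by have := takagi_below_g_lim k0 x0 xg; lra.
- right; have [j [z [hz xE]]] := g_surj gx xk.
  exists j, z => //; split; first by rewrite /= in_itv.
  have q1 := pow4_ge1 (R := R) k; have q2 := pow4_ge1 (R := R) j.
  by rewrite xE takagi_g // exprD; field; lra.
Qed.

Lemma L_0_0 : L 0 (0 : R).
Proof. by split; [rewrite /= in_itv /=; lra|exact: takagi0]. Qed.

Lemma L_0_1 : L 0 (1 : R).
Proof. by split; [rewrite /= in_itv /=; lra|exact: takagi1]. Qed.

Lemma trivIset_g k y : (0 < k)%N ->
  trivIset [set: nat] (fun j => g k j @` L (4 ^+ j * (4 ^+ k * (y - t k)))) <->
  y <> t k.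
Proof.
move=> k0; split.
- move=> /[swap] -> /(_ 0%N 1%N I I) h; suff : 0%N = 1%N by [].
  (* At height [t k] both levels are 0, and the first two pieces share the endpoint g k 0 0 = g k 1
     1. *)
  apply: h; exists (g k 0 0); rewrite subrr !mulr0; split.
    by exists 0 => //; exact: L_0_0.
  exists 1; first exact: L_0_1.
  have q1 := pow4_ge1 (R := R) k.
  by rewrite !gE !exprD expr1; field; lra.
- move=> yt i j _ _ [x [[a [ha Ta] <-] [b [hb Tb] /esym e]]].
  rewrite /= !in_itv /= in ha hb.
  have q1 := pow4_ge1 (R := R) k.
  (* An overlap forces the preimage in the earlier piece to be 0; since T(0) = 0, that would put y
     at [t k]. *)
  have key m c : takagi c = 4 ^+ m * (4 ^+ k * (y - t k)) -> c <> 0.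
    move=> Tc c0; apply: yt; move/eqP: Tc; rewrite c0 takagi0 eq_sym.
    by rewrite !mulf_eq0 !expf_eq0 !pnatr_eq0 !andbF subr_eq0 => /eqP.
  have [ij|ji|//] := ltngtP i j.
  + by case: (key _ _ Ta); exact: (g_overlap ij ha hb e).
  + by case: (key _ _ Tb); exact: (g_overlap ji hb ha (esym e)).
Qed.

(** This is where [Psi] would send the upper end of [Ik k.+3]; it bounds the level fed to [f]. *)
Lemma t_quarter k : 4 * (t k.+2 - t k.+3) = t k.+1 :> R.
Proof.
have p1 := pow2_ge1 (R := R) k.+1.
rewrite /t (exprSr _ k.+2) (exprSr _ k.+1) -(@natr1 _ k.+2) -(@natr1 _ k.+1).
field; lra.
Qed.

(** The level of z is below t_(k-2), so [takagi_ge_t] forces 2^(k-2) z < 1, which is the range of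
    [takagi_f]. *)
Lemma f_image_L0 k y x : (2 < k)%N -> y < t k.-1 ->
  (f k @` L0 (4 * (y - t k))) x ->
  2 ^- k <= x <= 2^-1 /\ takagi x = y.
Proof.
case: k => [|[|[|k]]] //= _ yt [z [hz Tz] <-]; rewrite /= in_itv /= in hz.
have p1 := pow2_ge1 (R := R) k.
have zk : 2 ^+ k.+1 * z < 1.
  rewrite ltNge; apply/negP => h.
  have := @takagi_ge_t _ k.+1 z isT h; rewrite Tz.
  by have := t_quarter k; lra.
split; last first.
  rewrite takagi_f ?Tz //; [by field|lra|].
  by rewrite 2!exprSr -2!mulrA; lra.
have k8 : 2 ^- k.+3 <= 8^-1 :> R.
  by rewrite lef_pV2 ?posrE ?exprn_gt0 // !exprS; lra.
by rewrite /f; lra.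
Qed.

(** A height below t_(k-1) keeps [x] left of 2^-(k-1), so its preimage under [f k] is within the
    range of [takagi_f]. *)
Lemma f_level k y x : (2 < k)%N -> 2 ^- k <= x <= 2^-1 -> takagi x < t k.-1 ->
  (f k @` L0 (4 * (takagi x - t k))) x.
Proof.
case: k => [|[|[|k]]] //= _ hx xt.
have p1 := pow2_ge1 (R := R) k.
have zk : 2 ^+ k.+2 * x < 1.
  by rewrite ltNge; apply/negP => /(@takagi_ge_t _ k.+2 x isT); lra.
have xE : x = f k.+3 (4 * (x - 2 ^- k.+3)).
  by rewrite /f; field; rewrite expf_neq0.
have pE : 2 ^+ k.+3 * (4 * (x - 2 ^- k.+3)) = 8 * (2 ^+ k.+2 * x) - 4.
  by rewrite (exprS _ k.+2); field; rewrite expf_neq0.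
exists (4 * (x - 2 ^- k.+3)); last by rewrite -xE.
split; last first.
  by rewrite {2}xE takagi_f // ?pE; [field|lra|lra].
rewrite /= in_itv /=; apply/andP; split; first by lra.
have : 2 ^+ k.+3 * (4 * (x - 2 ^- k.+3)) <= 4 by rewrite pE; lra.
by rewrite !exprS; nra.
Qed.

Lemma takagi_dyadic k : takagi (2 ^- k) = t k :> R.
Proof.
have := @takagi_near_dyadic R k 0.
by rewrite takagi0 !mul0r subr0 addr0 => -> //; lra.
Qed.

Lemma Ik_ge3 k y : (2 < k)%N -> Ik k y = (t k <= y < t k.-1) :> Prop.
Proof. by case: k => [|[|[|k]]] // _; rewrite /Ik /= in_itv. Qed.

Lemma Ik_lt_half k y : (2 < k)%N -> y < t k.-1 -> y < 2^-1.
Proof.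
move=> k2 h; apply: (lt_le_trans h).
have <- : t 1 = 2^-1 :> R by rewrite /t expr1 mul1r.
by apply: t_nonincreasing => //; case: k k2 {h} => [|[|[|k]]].
Qed.

Lemma indexE k y : (2 < k)%N -> Ik k y -> Defs.index y = k.
Proof.
move=> k2 Iky; have := Iky; rewrite Ik_ge3 // => /andP[y1 y2].
rewrite /Defs.index; case: xgetP => [m _ [m2 Imy]|/(_ k)]; last first.
  by case; split=> //; exact: ltnW.
have y3 := Ik_lt_half k2 y2.
(* Index 2 is excluded because [Ik 2] starts at 1/2 and y < 1/2. *)
have {}m2 : (2 < m)%N.
  rewrite ltn_neqAle m2 andbT; apply/eqP => e; move: Imy.
  by rewrite -e /Ik /= in_itv /=; lra.
move: Imy; rewrite Ik_ge3 // => /andP[z1 z2].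
have aux a b : (2 < b)%N -> (a < b)%N -> (2 < a)%N ->
    t a <= y -> y < t b.-1 -> False.
  move=> b2 ab a2 ay yb.
  have : t b.-1 <= t a :> R.
    by apply: t_nonincreasing; [exact: leq_trans a2|case: b ab {b2 yb}].
  by lra.
by have [mk|km|//] := ltngtP m k; exfalso; [apply: (aux m k)|apply: (aux k m)].
Qed.

Lemma Psi_ge3 k y : (2 < k)%N -> Ik k y -> Psi y = 4 * (y - t k).
Proof.
move=> k2 Iky; rewrite /Psi (indexE k2 Iky).
move: Iky; rewrite Ik_ge3 // => /andP[y1 _].
have t0 := @t_gt0 R k (ltn_trans (isT : 0 < 2)%N k2).
by case: eqP => // ?; lra.
Qed.

Lemma Phi_ge3 k y : (2 < k)%N -> Ik k y -> Phi y = 4 ^+ k * (y - t k).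
Proof.
move=> k2 Iky; rewrite /Phi (indexE k2 Iky).
move: Iky; rewrite Ik_ge3 // => /andP[y1 /(Ik_lt_half k2) y2].
have t0 := @t_gt0 R k (ltn_trans (isT : 0 < 2)%N k2).
by rewrite [_ <= y]leNgt y2 /=; case: eqP => // ?; lra.
Qed.

Lemma t1 : t 1 = 2^-1 :> R.
Proof. by rewrite /t expr1 mul1r. Qed.

(** Writing 1/2 as [t 1] and 4 as 4^1 makes this interval the case k = 1 of the dyadic lemmas. *)
Lemma Phi_2 y : Ik 2 y -> 2^-1 <= y /\ Phi y = 4 ^+ 1 * (y - t 1).
Proof.
rewrite /Ik /= in_itv /= => /andP[y1 _]; split=> //.
by rewrite /Phi y1 t1 expr1; case: eqP => // ?; lra.
Qed.

Lemma L_sym y x : L y (1 - x) <-> L y x.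
Proof.
by rewrite /L /= takagi_sym !in_itv /=; split=> -[h ?]; split=> //; lra.
Qed.

Lemma L_split y : L y = L0 y `|` [set 1 - a | a in L0 y].
Proof.
apply/seteqP; split=> [x [hx Tx]|x [[hx Tx]|[a [ha Ta] <-]]].
- rewrite /= in_itv /= in hx.
  have [x2|x2] := leP x 2^-1.
    by left; split=> //; rewrite /= in_itv /=; lra.
  right; exists (1 - x); last by lra.
  by split; rewrite ?takagi_sym //= in_itv /=; lra.
- by rewrite /= in_itv /= in hx; split=> //; rewrite /= in_itv /=; lra.
- rewrite /= in_itv /= in ha; apply/L_sym; split=> //.
  by rewrite /= in_itv /=; lra.
Qed.

Lemma L0_disjoint_sym y :
  L0 y `&` [set 1 - a | a in L0 y] = set0 <-> y <> 2^-1.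
Proof.
split.
- move=> /[swap] -> e; suff : (set0 : set R) 2^-1 by [].
  have h : L0 2^-1 (2^-1 : R).
    by split; [rewrite /= in_itv /=; lra|exact: takagi_1half].
  by rewrite -e; split=> //; exists 2^-1 => //; lra.
- move=> yh; apply/seteqP; split=> // x [[hx Tx] [a [ha _] e]]; apply: yh.
  rewrite /= !in_itv /= in hx ha.
  by rewrite -Tx (_ : x = 2^-1) ?takagi_1half; lra.
Qed.

Lemma L0_dyadic k y x : (0 < k)%N -> t k <= y -> L0 y x -> x <= 2 ^- k ->
  (\bigcup_(j in [set: nat]) (g k j @` L (4 ^+ j * (4 ^+ k * (y - t k))))) x \/
  (x = g_lim k /\ y = t k).
Proof.
move=> k0 ty [hx Tx] xk; rewrite /= in_itv /= in hx.
have [||xg|[j hj]] := @dyadic_level k x k0; rewrite ?Tx //; first by lra.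
- by right; rewrite -Tx xg takagi_g_lim.
- by left; exists j => //; rewrite Tx in hj.
Qed.

Lemma pow2V_le_half k : (0 < k)%N -> 2 ^- k <= 2^-1 :> R.
Proof.
case: k => // k _; rewrite lef_pV2 ?posrE ?exprn_gt0 // exprS.
by have := pow2_ge1 (R := R) k; lra.
Qed.

Lemma bigcup_g_subset k y : (0 < k)%N ->
  \bigcup_(j in [set: nat]) (g k j @` L (4 ^+ j * (4 ^+ k * (y - t k))))
    `<=` L0 y.
Proof.
move=> k0 x [j _ /(g_image_L k0)[hx Tx]]; split=> //; rewrite /= in_itv /=.
have := @g_lim_ge0 R k k0; have := pow2V_le_half k0; lra.
Qed.

(** The pieces accumulate at this point without containing it, so at y = [t k] it has to be added to
    the union. *)
Lemma g_lim_L0 k : (0 < k)%N -> L0 (t k) (g_lim k : R).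
Proof.
move=> k0; split; last exact: takagi_g_lim.
rewrite /= in_itv /= g_lim_ge0 //=; apply: le_trans (pow2V_le_half k0).
have := pow4_ge1 (R := R) k; rewrite /g_lim.
have : 0 < 4 ^- k :> R by rewrite invr_gt0 exprn_gt0.
lra.
Qed.

Lemma f_subset k y : (2 < k)%N -> y < t k.-1 ->
  f k @` L0 (4 * (y - t k)) `<=` L0 y.
Proof.
move=> k2 yt x /(f_image_L0 k2 yt)[hx Tx]; split=> //; rewrite /= in_itv /=.
have : 0 <= 2 ^- k :> R by rewrite invr_ge0 exprn_ge0.
lra.
Qed.

(** The point 2^-k separates the two kinds of pieces: [g] covers its left side, [f] its right
    side. *)
Lemma L0_cover_ge3 k y x : (2 < k)%N -> t k <= y < t k.-1 -> L0 y x ->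
  (f k @` L0 (4 * (y - t k)) `|`
   \bigcup_(j in [set: nat]) (g k j @` L (4 ^+ j * (4 ^+ k * (y - t k))))) x \/
  (x = g_lim k /\ y = t k).
Proof.
move=> k2 /andP[y1 y2] Lx; have k0 : (0 < k)%N by exact: leq_trans k2.
have [xk|kx] := leP x (2 ^- k).
  by have [?|?] := L0_dyadic k0 y1 Lx xk; [left; right|right].
case: Lx => hx Tx; rewrite /= in_itv /= in hx.
by left; left; rewrite -Tx; apply: f_level; rewrite ?Tx //; lra.
Qed.

(** The two images lie on opposite sides of 2^-k, where T takes the value [t k]. *)
Lemma f_g_disjoint k j y : (2 < k)%N -> y < t k.-1 -> y <> t k ->
  f k @` L0 (4 * (y - t k)) `&` g k j @` L (4 ^+ j * (4 ^+ k * (y - t k))) =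
  set0.
Proof.
move=> k2 y2 yt; apply/seteqP; split=> // x [/(f_image_L0 k2 y2)[hx Tx]].
move=> /(g_image_L (leq_trans _ k2))[//|gx _]; apply: yt.
by rewrite -Tx (_ : x = 2 ^- k) ?takagi_dyadic; lra.
Qed.

End LevelSets.

Theorem theorem3p1 (R : realType) :
  [/\
   (forall y : R, 0 <= y ->
     L y = L0 y `|` [set 1 - a | a in L0 y] /\
     (L0 y `&` [set 1 - a | a in L0 y] = set0 <-> y <> 2^-1)),
   (forall (k : nat) (y : R), (3 <= k)%N -> Ik k y ->
     [/\ (y <> t k ->
          L0 y = f k @` L0 (Psi y) `|`
                 \bigcup_(j in [set: nat]) (g k j @` L (4 ^+ j * Phi y))),
         (y = t k ->
          L0 y = f k @` L0 (Psi y) `|`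
                 \bigcup_(j in [set: nat]) (g k j @` L (4 ^+ j * Phi y)) `|`
                 [set g_lim k]) &
         ((forall j : nat,
             f k @` L0 (Psi y) `&` g k j @` L (4 ^+ j * Phi y) = set0) /\
          trivIset [set: nat] (fun j : nat => g k j @` L (4 ^+ j * Phi y))
          <-> y <> t k)]) &
   (forall y : R, Ik 2 y ->
     [/\ (y <> 2^-1 ->
          L0 y = \bigcup_(j in [set: nat]) (g 1 j @` L (4 ^+ j * Phi y))),
         (y = 2^-1 ->
          L0 y = \bigcup_(j in [set: nat]) (g 1 j @` L (4 ^+ j * Phi y)) `|`
                 [set g_lim 1]) &
         (trivIset [set: nat] (fun j : nat => g 1 j @` L (4 ^+ j * Phi y))
          <-> y <> 2^-1)])].
Proof.
split.
- by move=> y _; split; [exact: L_split|exact: L0_disjoint_sym].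
- move=> k y k3 Iky; rewrite (Psi_ge3 k3 Iky) (Phi_ge3 k3 Iky).
  move: Iky; rewrite Ik_ge3 // => hy; have /andP[y1 y2] := hy.
  have k0 : (0 < k)%N by exact: leq_trans k3.
  split.
  + move=> yt; apply/seteqP; split.
      by move=> x /(L0_cover_ge3 k3 hy)[//|[]].
    by rewrite subUset; split; [exact: f_subset|exact: bigcup_g_subset].
  + move=> yt; apply/seteqP; split.
      by move=> x /(L0_cover_ge3 k3 hy)[?|[? _]]; [left|right].
    rewrite !subUset; split.
      by split; [exact: f_subset|exact: bigcup_g_subset].
    by move=> _ ->; rewrite yt; exact: g_lim_L0.
  + split=> [[_ /(trivIset_g _ k0)]//|yt].
    by split; [move=> j; exact: f_g_disjoint|exact/trivIset_g].
(* With k = 1 all of [0, 1/2] lies left of 2^-k, so the pieces of [g 1] alone cover it. *)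
- move=> y /Phi_2[y1 ->]; rewrite -t1 in y1 *.
  have xle x : L0 y x -> x <= 2 ^- 1.
    by move=> [+ _]; rewrite /= in_itv /= expr1 => /andP[].
  split.
  + move=> yt; apply/seteqP; split; last exact: bigcup_g_subset.
    by move=> x Lx; have [//|[]] := L0_dyadic (ltn0Sn 0) y1 Lx (xle x Lx).
  + move=> yt; apply/seteqP; split.
      move=> x Lx.
      by have [?|[? _]] := L0_dyadic (ltn0Sn 0) y1 Lx (xle x Lx); [left|right].
    rewrite subUset; split; first exact: bigcup_g_subset.
    by move=> _ ->; rewrite {1}yt; exact: g_lim_L0.
  + exact: trivIset_g.
Qed.
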